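(* Let $N\ge 1$, let $\mathcal{X}\in\mathbb{R}^{I_1\times\cdots\times I_N}$ be a tensor with set of observable entries $\Omega$, let $\lambda>0$, and let $\mathcal{G}\in\mathbb{R}^{J_1\times\cdots\times J_N}$ and $\mathbf{A}^{(n)}\in\mathbb{R}^{I_n\times J_n}$ ($n=1,\dots,N$). Define $$L_F(\mathcal{G},\mathbf{A}^{(1)},\dots,\mathbf{A}^{(N)})=\sum_{\alpha=(i_1,\dots,i_N)\in\Omega}\Big(\mathcal{X}_\alpha-\sum_{\gamma}\mathcal{G}_\gamma\, p_{\alpha,\gamma}\Big)^2+\lambda\Big(\|\mathcal{G}\|_F^2+\sum_{n=1}^N\|\mathbf{A}^{(n)}\|_F^2\Big),$$ where, for $\alpha=(i_1,\dots,i_N)$ and a core-tensor index $\gamma=(j_1,\dots,j_N)$, $p_{\alpha,\gamma}=\prod_{n=1}^N a^{(n)}_{i_nj_n}$. Fix a core-tensor index $\beta$ and regard $L_F$ as a function of the single real variable $\mathcal{G}_\beta$, all other entries of $\mathcal{G}$ and all entries of the factor matrices being held fixed. Then $$\operatorname*{arg\,min}_{\mathcal{G}_\beta}L_F(\mathcal{G},\mathbf{A}^{(1)},\dots,\mathbf{A}^{(N)})=\frac{\sum_{\alpha\in\Omega}\Big(\mathcal{X}_\alpha-\sum_{\gamma\ne\beta}\mathcal{G}_\gamma\, p_{\alpha,\gamma}\Big)\,p_{\alpha,\beta}}{\lambda+\sum_{\alpha\in\Omega}p_{\alpha,\beta}^2}.$$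
   Context: $\Omega\subseteq\{1,\dots,I_1\}\times\cdots\times\{1,\dots,I_N\}$ is the set of indices of observed entries of $\mathcal{X}$. $a^{(n)}_{ij}$ denotes the $(i,j)$ entry of $\mathbf{A}^{(n)}$. $\|\cdot\|_F$ is the Frobenius norm. $\gamma$ ranges over all indices $(j_1,\dots,j_N)$ of $\mathcal{G}$. *)

(* Defs.v *)
From HB Require Import structures.
From mathcomp Require Import all_boot all_order all_algebra.
From mathcomp Require Import classical_sets reals.

Set Implicit Arguments.
Unset Strict Implicit.
Unset Printing Implicit Defensive.

Import Order.TTheory GRing.Theory Num.Theory.

Local Open Scope ring_scope.

(* The reals are an arbitrary [R : realType].  Modes and positions are 0-based: an element of [midx d] is a tuple
   (k_0, ..., k_(N-1)) with k_n < d n. *)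
Definition midx (N : nat) (d : 'I_N -> nat) : finType :=
  {dffun forall n : 'I_N, 'I_(d n)}.

Definition tensor (R : realType) (N : nat) (d : 'I_N -> nat) : Type :=
  {ffun midx d -> R}.

Definition tensor_frob (R : realType) (N : nat) (d : 'I_N -> nat)
    (T : tensor R d) : R :=
  Num.sqrt (\sum_(k : midx d) T k ^+ 2).

Definition mx_frob (R : realType) (m n : nat) (M : 'M[R]_(m, n)) : R :=
  Num.sqrt (\sum_(i < m) \sum_(j < n) M i j ^+ 2).

Section Loss.
Variables (R : realType) (N : nat) (I J : 'I_N -> nat).
Implicit Types (A : forall n : 'I_N, 'M[R]_(I n, J n)).

Definition pcoef A (alpha : midx I) (gamma : midx J) : R :=
  \prod_(n < N) A n (alpha n) (gamma n).

Definition LF (X : tensor R I) (Omega : {set midx I}) (lambda : R)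
    (G : tensor R J) A : R :=
  \sum_(alpha in Omega)
     (X alpha - \sum_(gamma : midx J) G gamma * pcoef A alpha gamma) ^+ 2
  + lambda * (tensor_frob G ^+ 2 + \sum_(n < N) mx_frob (A n) ^+ 2).

End Loss.

Definition set_entry (R : realType) (N : nat) (d : 'I_N -> nat)
    (T : tensor R d) (k0 : midx d) (x : R) : tensor R d :=
  [ffun k => if k == k0 then x else T k].

(* The set of all global minimisers, so that [argmin f = [set v]] says that [v]
   is a minimiser and the only one. *)
Definition argmin (R : realType) (f : R -> R) : set R :=
  [set x | forall y, f x <= f y]%classic.

(* Main.v *)
Require Import Defs.
From HB Require Import structures.
From mathcomp Require Import all_boot all_order all_algebra.
From mathcomp Require Import classical_sets reals.
From mathcomp Require Import ring.

Set Implicit Arguments.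
Unset Strict Implicit.
Unset Printing Implicit Defensive.

Import Order.TTheory GRing.Theory Num.Theory.

Local Open Scope ring_scope.

(** In the single variable x = G_beta every residual is affine, [r alpha - x * pcoef A alpha beta],
    and the penalty is lambda x^2 plus a constant. So the loss is a x^2 - 2 b x + c, with a = lambda
    + sum p^2 and b = sum r p. Since lambda > 0, a is positive, and completing the square
    ([argmin_quadratic]) makes b / a the unique minimiser. *)

Lemma argmin_quadratic (R : realType) (f : R -> R) (a b c : R) :
  0 < a -> (forall x, f x = a * x ^+ 2 - 2 * b * x + c) ->
  argmin f = [set b / a]%classic.
Proof.
move=> a_gt0 fE; have a_neq0 : a != 0 by rewrite gt_eqF.
have f_min x : f x = f (b / a) + a * (x - b / a) ^+ 2 by rewrite !fE; field.
apply/seteqP; split=> [x /(_ (b / a))|_ -> y] /=; last first.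
  by rewrite [f y]f_min lerDl mulr_ge0 ?sqr_ge0 // ltW.
(* Uniqueness: a minimiser does no worse than b / a, so its square term is at most 0 and hence
   vanishes. *)
rewrite [f x]f_min gerDl pmulr_rle0 // => sqr_le0.
by apply/eqP; rewrite -subr_eq0 -sqrf_eq0 eq_le sqr_le0 sqr_ge0.
Qed.

Lemma tensor_frob_sqr (R : realType) (N : nat) (d : 'I_N -> nat)
    (T : tensor R d) :
  tensor_frob T ^+ 2 = \sum_(k : midx d) T k ^+ 2.
Proof. by rewrite sqr_sqrtr // sumr_ge0 // => k _; exact: sqr_ge0. Qed.

(** [F] also sees the index, so that x can be isolated both in the squared norm and in the inner
    sums weighted by [pcoef]. *)
Lemma sum_set_entry (R : realType) (N : nat) (d : 'I_N -> nat)
    (T : tensor R d) (k0 : midx d) (x : R) (F : midx d -> R -> R) :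
  \sum_k F k (set_entry T k0 x k) = F k0 x + \sum_(k | k != k0) F k (T k).
Proof.
rewrite (bigD1 k0) //= ffunE eqxx; congr (_ + _).
by apply: eq_bigr => k /negPf k_neq; rewrite ffunE k_neq.
Qed.

Lemma sum_sqr_residual (R : comPzRingType) (T : finType) (S : {set T})
    (r p : T -> R) (x : R) :
  \sum_(i in S) (r i - x * p i) ^+ 2 =
  (\sum_(i in S) p i ^+ 2) * x ^+ 2 - 2 * (\sum_(i in S) r i * p i) * x
  + \sum_(i in S) r i ^+ 2.
Proof.
rewrite mulr_sumr !mulr_suml -sumrB -big_split /=.
by apply: eq_bigr => i _; ring.
Qed.

Theorem lemma2 (R : realType) (N : nat) (hN : (1 <= N)%N)
    (I J : 'I_N -> nat)
    (X : tensor R I) (Omega : {set midx I})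
    (lambda : R) (hlambda : 0 < lambda)
    (G : tensor R J) (A : forall n : 'I_N, 'M[R]_(I n, J n))
    (beta : midx J) :
  argmin (fun x : R => LF X Omega lambda (set_entry G beta x) A) =
  [set ((\sum_(alpha in Omega)
           (X alpha - \sum_(gamma : midx J | gamma != beta)
                        G gamma * pcoef A alpha gamma) * pcoef A alpha beta)
        / (lambda + \sum_(alpha in Omega) pcoef A alpha beta ^+ 2))]%classic.
Proof.
pose r alpha := X alpha - \sum_(gamma | gamma != beta)
                            G gamma * pcoef A alpha gamma.
(* The part of the loss free of x; a and b are read off the claimed quotient by unification. *)
pose c := \sum_(alpha in Omega) r alpha ^+ 2
  + lambda * (\sum_(gamma | gamma != beta) G gamma ^+ 2
              + \sum_(n < N) mx_frob (A n) ^+ 2).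
apply: (argmin_quadratic (c := c)) => [|x].
  by rewrite ltr_pwDl // sumr_ge0 // => alpha _; exact: sqr_ge0.
rewrite /LF tensor_frob_sqr (sum_set_entry _ _ _ (fun _ y => y ^+ 2)).
under eq_bigr => alpha _.
  rewrite (sum_set_entry _ _ _ (fun gamma y => y * pcoef A alpha gamma)).
  (* Regroup the residual into the affine form that [sum_sqr_residual] expands. *)
  rewrite opprD addrCA addrC -/(r alpha); over.
by rewrite sum_sqr_residual /c /r; ring.
Qed.
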